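(* Fix a collection of chains $\mathbf{C}=\{C_1,C_2,\ldots,C_k\}$ in a finite poset $P$. Suppose these chains have the property that each element of $C_i$ is comparable with every element of $C_j$ provided $|i-j|>1$. Then for any $\pi,\omega\in\mathfrak{S}_k$, there is an equivariant bijection between $\mathcal{C}(P)$ under $t_{\mathbf{C}(\pi)}$ and $\mathcal{C}(P)$ under $t_{\mathbf{C}(\omega)}$; that is, a bijection $\varphi:\mathcal{C}(P)\to\mathcal{C}(P)$ with $\varphi\circ t_{\mathbf{C}(\pi)}=t_{\mathbf{C}(\omega)}\circ\varphi$.
   Context: A chain in a poset $P$ is a set of mutually comparable elements; $\mathcal{C}(P)\subseteq 2^P$ is the set of chains of $P$ (including $\emptyset$). For $p\in P$ the toggle $t_p:\mathcal{C}(P)\to\mathcal{C}(P)$ is given by $t_p(X)=X\cup\{p\}$ if $p\notin X$ and $X\cup\{p\}\in\mathcal{C}(P)$; $t_p(X)=X\setminus\{p\}$ if $p\in X$ and $X\setminus\{p\}\in\mathcal{C}(P)$; and $t_p(X)=X$ otherwise. For a chain $C$ of $P$, $t_C$ denotes the composition of all toggles $t_p$ for $p\in C$ (these commute, so the order does not matter). For $\mathbf{C}=\{C_1,\ldots,C_k\}$ and $\pi\in\mathfrak{S}_k$, $t_{\mathbf{C}(\pi)}:=t_{C_{\pi(1)}}t_{C_{\pi(2)}}\cdots t_{C_{\pi(k)}}$. *)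

(* Defs.v *)
From HB Require Import structures.
From mathcomp Require Import all_boot all_order all_fingroup all_algebra.

Set Implicit Arguments.
Unset Strict Implicit.
Unset Printing Implicit Defensive.

Section Chains.
Context {d : Order.disp_t} {P : finPOrderType d}.

Definition is_chain (X : {set P}) : bool :=
  [forall x in X, forall y in X, (x >=< y)%O].

Record chain := Chain { chain_set :> {set P}; _ : is_chain chain_set }.

HB.instance Definition _ := [isSub for chain_set].
HB.instance Definition _ := [Finite of chain by <:].

(* [insubd X Y] is the chain [Y] if the set [Y] is a chain, and [X] otherwise. *)
Definition toggle (p : P) (X : chain) : chain :=
  if p \notin X then insubd X (p |: X) else insubd X (X :\ p).

(* The composition follows the enumeration order of [P]; this choice is
   immaterial since the toggles at comparable elements commute. *)
Definition chain_toggle (C : chain) : chain -> chain :=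
  \big[(fun f g => f \o g)/id]_(p in C) toggle p.

(* Composition of functions: [chain_toggle (C (pi i))] with [i] maximal is
   applied first. *)
Definition chains_toggle (k : nat) (C : 'I_k -> chain) (pi : 'S_k) :
    chain -> chain :=
  \big[(fun f g => f \o g)/id]_(i < k) chain_toggle (C (pi i)).

End Chains.

Arguments chain {d} P.

(* Main.v *)
Require Import Defs.
From mathcomp Require Import all_boot all_order all_fingroup all_algebra.

(** The toggles are involutions of the finite set of chains, and toggles at
    comparable elements commute.  Hence the toggles [g_1, ..., g_k] at the given
    chains live in a finite symmetric group, and [g_i], [g_j] commute whenever
    [|i - j| > 1].  As for Coxeter elements of a path, all products of the [g_i]
    in some order are then conjugate: [g_k] commutes with every other factor
    but [g_(k-1)], so up to a cyclic rotation it can be brought right after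
    [g_(k-1)]; merging the two factors reduces [k] by one. *)

Section PathCoxeter.
Local Open Scope group_scope.
Variable gT : finGroupType.
Implicit Types (g : nat -> gT) (s : seq nat).

Lemma commute_prod (I : Type) (r : seq I) (Q : pred I) (x : gT) (F : I -> gT) :
    (forall i, Q i -> commute x (F i)) ->
  commute x (\prod_(i <- r | Q i) F i).
Proof.
by move=> xF; apply: big_ind => //; [apply: commute1 | apply: commuteM].
Qed.

(** The order of the factors is a list [s], so that an index is removed by splitting [s]. The
    induction keeps [g] general, since it passes to a merged family. *)
Lemma path_prod_conj k g s :
    (forall i j, i.+1 < j < k -> commute (g i) (g j)) -> perm_eq s (iota 0 k) ->
  exists h, (\prod_(i <- s) g i) ^ h = \prod_(i <- iota 0 k) g i.
Proof.
elim: k g s => [|[|k] IHk] g s gC s_iota.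
- by exists 1; rewrite conjg1 (perm_nilP s_iota).
- by exists 1; rewrite conjg1 (perm_small_eq _ s_iota).
have s_uniq : uniq s by rewrite (perm_uniq s_iota) iota_uniq.
have mem_s i : (i \in s) = (i < k.+2) by rewrite (perm_mem s_iota) mem_iota.
(* Once [k] and [k.+1] are excluded, every index in [r] is below [k], hence at distance at least 2
   from [k.+1]. *)
have gkC r : {subset r <= s} -> k \notin r -> k.+1 \notin r ->
    commute (g k.+1) (\prod_(i <- r) g i).
  move=> rs kr k1r; rewrite big_seq; apply: commute_prod => i ri.
  apply/commute_sym/gC.
  have := rs i ri; rewrite mem_s ltnS leq_eqVlt => /predU1P[ik|].
    by rewrite -ik ri in k1r.
  rewrite ltnS leq_eqVlt => /predU1P[ik|ltik]; first by rewrite -ik ri in kr.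
  by rewrite ltnS ltik ltnSn.
pose g' i := if i == k then g k * g k.+1 else g i.
have iota_g' : \prod_(i <- iota 0 k.+1) g' i = \prod_(i <- iota 0 k.+2) g i.
  rewrite -[in RHS](addn2 k) -[in LHS](addn1 k) !iotaD !big_cat /= add0n.
  rewrite !big_cons !big_nil /g' eqxx !mulg1; congr (_ * _).
  apply: eq_big_seq => i; rewrite mem_iota => /andP[_ ltik].
  by rewrite ltn_eqF.
have [s' [h [s'_iota s'h]]] : exists s' h, perm_eq s' (iota 0 k.+1) /\
    (\prod_(i <- s) g i) ^ h = (\prod_(i <- s') g i) * g k.+1.
  have k1s: k.+1 \in s by rewrite mem_s.
  case/splitPr: s / k1s s_iota s_uniq mem_s gkC => s1 s2 s_iota.
  rewrite cat_uniq /= negb_or => /and4P[_ /andP[k1s1 s12] k1s2 _] mem_s gkC.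
  have perm12 : perm_eq (s1 ++ s2) (iota 0 k.+1).
    have: perm_eq (s1 ++ k.+1 :: s2) (k.+1 :: iota 0 k.+1).
      rewrite (perm_trans s_iota) // -(addn1 k.+1) iotaD cats1.
      by rewrite -rot1_cons perm_rot.
    by rewrite -cat1s perm_catCA /= perm_cons.
  (* If [k] precedes [k.+1], then [g k.+1] commutes past [s2] to the right end. Otherwise it
     commutes past [s1] to the front, and conjugation by it rotates it to the end. *)
  have [ks1|kNs1] := boolP (k \in s1).
    exists (s1 ++ s2), 1; split=> //.
    rewrite conjg1 !big_cat big_cons /= -mulgA.
    congr (_ * _); apply: gkC => //.
      by move=> i i2; rewrite mem_cat inE i2 !orbT.
    apply/negP=> ks2; case/hasP: s12; by exists k.
  exists (s1 ++ s2), (g k.+1); split=> //.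
  have g1C : commute (g k.+1) (\prod_(i <- s1) g i).
    by apply: gkC => // i i1; rewrite mem_cat i1.
  rewrite !big_cat big_cons /= conjgE !mulgA.
  by rewrite -(mulgA _^-1) -g1C !mulgA mulVg mul1g.
(* The last factor [g k.+1] moves left past everything that follows [g k]. *)
have s'g' : (\prod_(i <- s') g i) * g k.+1 = \prod_(i <- s') g' i.
  have s'_uniq : uniq s' by rewrite (perm_uniq s'_iota) iota_uniq.
  have mem_s' i : (i \in s') = (i < k.+1).
    by rewrite (perm_mem s'_iota) mem_iota.
  have ks' : k \in s' by rewrite mem_s'.
  case/splitPr: s' / ks' s'_uniq mem_s' {s'_iota s'h} => s1 s2.
  rewrite cat_uniq /= negb_or => /and4P[_ /andP[ks1 _] ks2 _] mem_s'.
  have g'E r : k \notin r -> \prod_(i <- r) g' i = \prod_(i <- r) g i.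
    move=> kr; apply: eq_big_seq => i ri; rewrite /g'; case: eqP => // ik.
    by rewrite -ik ri in kr.
  rewrite !big_cat !big_cons /= !g'E // {1}/g' eqxx -!mulgA.
  congr (_ * (_ * _)); apply/esym/gkC => //.
    move=> i i2; rewrite mem_s ltnW // ltnS -mem_s'.
    by rewrite mem_cat inE i2 !orbT.
  apply/negP=> k12; have := mem_s' k.+1.
  by rewrite mem_cat inE k12 !orbT ltnn.
(* The merged factor can only occur at [j = k]; there [i.+1 < k], so [g i] commutes with both [g k]
   and [g k.+1]. *)
have [|h' h'P] := IHk g' s' _ s'_iota.
  move=> i j /andP[ltij ltjk]; rewrite /g' (ltn_eqF (_ : i < k)); last first.
    by rewrite -ltnS (leq_trans _ ltjk) // ltnW.
  case: eqP => [jk|_]; last by apply: gC; rewrite ltij ltnW.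
  apply: commuteM; apply: gC; rewrite -jk ?ltij ?ltnSn ?andbT; exact: ltnW.
by exists (h * h'); rewrite conjgM s'h s'g' h'P.
Qed.

Lemma path_prod_conj_ord (k : nat) (g : 'I_k -> gT) (pi : 'S_k) :
    (forall i j : 'I_k, i.+1 < j -> commute (g i) (g j)) ->
  exists h, (\prod_(i < k) g (pi i)) ^ h = \prod_(i < k) g i.
Proof.
move=> gC; pose g' n := if insub n is Some i then g i else 1.
have g'E (i : 'I_k) : g' i = g i by rewrite /g' valK.
pose s := [seq val (pi i) | i <- index_enum 'I_k].
have vE : [seq val i | i <- index_enum 'I_k] = iota 0 k.
  by rewrite -val_enum_ord enumT.
have s_iota : perm_eq s (iota 0 k).
  rewrite -vE /s (map_comp val pi); apply/perm_map/uniq_perm.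
  - by rewrite map_inj_uniq ?index_enum_uniq //; apply: perm_inj.
  - exact: index_enum_uniq.
  move=> i; rewrite mem_index_enum; apply/mapP.
  by exists ((pi^-1) i); rewrite ?mem_index_enum ?permKV.
have [|h hP] := @path_prod_conj k g' s _ s_iota.
  move=> i j /andP[ltij ltjk].
  have ltik : i < k by rewrite (leq_trans _ ltjk) // ltnS ltnW // ltnW.
  by rewrite (g'E (Ordinal ltik)) (g'E (Ordinal ltjk)); apply: gC.
exists h; move: hP; rewrite -vE !big_map.
by under eq_bigr do rewrite g'E; under [in RHS]eq_bigr do rewrite g'E.
Qed.

End PathCoxeter.

Section Toggles.
Local Open Scope group_scope.

(* In [{perm T}] the left factor acts first, whence the inverses. *)
Lemma big_comp_perm {T : finType} {I : Type} (r : seq I) (Q : pred I)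
    (f : I -> T -> T) (F : I -> {perm T}) : (forall i, f i =1 F i) ->
  \big[(fun f g => f \o g)/id]_(i <- r | Q i) f i
    =1 (\prod_(i <- r | Q i) (F i)^-1)^-1.
Proof.
move=> fF; elim: r => [|i r IHr] x; first by rewrite !big_nil invg1 perm1.
rewrite !big_cons; case: ifP => // _.
by rewrite invMg invgK permM /= fF IHr.
Qed.

Context {d : Order.disp_t} {P : finPOrderType d}.
Implicit Types (p q z : P) (X : chain P).

Let cmp_all p X := [forall y in (X : {set P}), (p >=< y)%O].

(** Removing an element from a chain always leaves a chain, and [cmp_all p X] holds when [p] is in
    [X]; so one condition governs both insertion and removal. Involutivity and commutation then
    become identities for exclusive or. *)
Lemma mem_toggle p X z :
  (z \in toggle p X) =
  (z \in X) (+) ((z == p) && cmp_all p X).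
Proof.
have /forall_inP Xch : is_chain X by case: X.
have cmpX x y : x \in X -> y \in X -> (x >=< y)%O.
  by move=> /Xch/forall_inP; apply.
rewrite /toggle; case: ifPn => [pX | /negPn pX].
  rewrite val_insubd; have -> : is_chain (p |: X) = cmp_all p X.
    apply/forall_inP/forall_inP => [cX y yX | cX x].
      by have /forall_inP := cX p (setU11 _ _); apply; apply: setU1r.
    case/setU1P=> [->|xX]; apply/forall_inP=> y; case/setU1P=> [->|yX].
    - exact: Order.POrderTheory.comparablexx.
    - exact: cX.
    - by rewrite Order.POrderTheory.comparable_sym cX.
    - exact: cmpX.
  rewrite /cmp_all; case: ifP => _; last by rewrite andbF addbF.
  rewrite andbT in_setU1; case: eqP => [->|_] /=; last by case: (z \in _).
  by rewrite (negPf pX).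
have -> : cmp_all p X.
  by apply/forall_inP=> y; apply: cmpX.
rewrite val_insubd ifT; last first.
  apply/forall_inP=> x /setD1P[_ xX]; apply/forall_inP=> y /setD1P[_ yX].
  exact: cmpX.
rewrite in_setD1 andbT; case: eqP => [->|_] /=; last by case: (z \in _).
by rewrite pX.
Qed.

(** Only the membership of [q] can change, and [q] satisfies the condition anyway. *)
Lemma cmp_all_toggle p q X : (p >=< q)%O ->
  cmp_all p (toggle q X) = cmp_all p X.
Proof.
move=> pq; apply: eq_forallb => y; rewrite mem_toggle.
by case: eqP => [->|_]; rewrite ?pq ?implybT //= addbF.
Qed.

Lemma toggleK p : involutive (toggle p).
Proof.
move=> X; apply/val_inj/setP=> z /=; rewrite !mem_toggle.
by rewrite cmp_all_toggle ?Order.POrderTheory.comparablexx // addbK.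
Qed.

Lemma toggleC p q X : (p >=< q)%O ->
  toggle p (toggle q X) = toggle q (toggle p X).
Proof.
move=> pq; apply/val_inj/setP=> z /=; rewrite !mem_toggle.
rewrite !cmp_all_toggle ?addbA 1?addbAC //.
by rewrite Order.POrderTheory.comparable_sym.
Qed.

Definition toggle_perm p : {perm chain P} := perm (inv_inj (toggleK p)).

(** This is the inverse of [chain_toggle C]: with inverses, the factors keep the order of the
    composition. *)
Definition chain_toggle_permV (C : chain P) : {perm chain P} :=
  \prod_(p in C) (toggle_perm p)^-1.

Lemma chain_toggleE C : chain_toggle C =1 (chain_toggle_permV C)^-1.
Proof. by apply: big_comp_perm => p X; rewrite permE. Qed.

Lemma chains_toggleE (k : nat) (C : 'I_k -> chain P) (pi : 'S_k) :
  chains_toggle C pi =1 (\prod_(i < k) chain_toggle_permV (C (pi i)))^-1.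
Proof.
move=> X.
rewrite /chains_toggle (big_comp_perm _ _ _ _ (fun i => chain_toggleE _)).
by under eq_bigr do rewrite invgK.
Qed.

Lemma chain_toggle_permV_commute (C D : chain P) :
    (forall x y, x \in C -> y \in D -> (x >=< y)%O) ->
  commute (chain_toggle_permV C) (chain_toggle_permV D).
Proof.
move=> CD; apply: commute_prod => y yD; apply/commute_sym/commute_prod => x xC.
apply/commuteV/commute_sym/commuteV/permP=> X.
by rewrite !permM !permE toggleC // Order.POrderTheory.comparable_sym CD.
Qed.

End Toggles.

Theorem theorem3p10 (d : Order.disp_t) (P : finPOrderType d) (k : nat)
    (C : 'I_k -> chain P)
    (HC : forall i j : 'I_k, (1 < `|(i : nat) - (j : nat)|)%N ->
          forall x y : P, x \in C i -> y \in C j -> (x >=< y)%O)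
    (pi omega : 'S_k) :
  exists phi : chain P -> chain P,
    bijective phi /\
    phi \o chains_toggle C pi =1 chains_toggle C omega \o phi.
Proof.
pose g i := chain_toggle_permV (C i).
have gC (i j : 'I_k) : i.+1 < j -> commute (g i) (g j).
  move=> ltij; apply/commute_sym/chain_toggle_permV_commute/HC.
  by rewrite ssrint.IntDist.distnEl ?(ltnW (ltnW ltij)) // ltn_subRL addn1.
have [a aP] := path_prod_conj_ord _ k g pi gC.
have [b bP] := path_prod_conj_ord _ k g omega gC.
(* Conjugation by [a] takes the [pi] product to the product in natural order, and [b^-1] takes that
   to the [omega] product. *)
exists (a * b^-1)%g; split.
  by exists (a * b^-1)^-1%g; [apply: permK | apply: permKV].
move=> X; rewrite /= !chains_toggleE.
have -> : (\prod_(i < k) chain_toggle_permV (C (omega i))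
    = (\prod_(i < k) chain_toggle_permV (C (pi i))) ^ (a * b^-1))%g.
  by rewrite conjgM [in RHS]aP -bP conjgK.
by rewrite -conjVg permJ.
Qed.
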